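(* Let $q\in(0,1)$ and let $x,\lambda\in[0,\frac{1}{1-q})$. Then the function $\nu\mapsto E_\nu(\lambda x;q^2)$ is log-convex on $(0,\infty)$, i.e. for all $\nu_1,\nu_2>0$ and all $\alpha\in[0,1]$, $$E_{\alpha\nu_1+(1-\alpha)\nu_2}(\lambda x;q^2)\le\left[E_{\nu_1}(\lambda x;q^2)\right]^{\alpha}\left[E_{\nu_2}(\lambda x;q^2)\right]^{1-\alpha}.$$ In particular, the Turán type inequality for the $q$-Dunkl kernel holds: for all $\nu>0$, $$\left[E_{\nu+1}(\lambda x;q^2)\right]^2\le E_\nu(\lambda x;q^2)\,E_{\nu+2}(\lambda x;q^2).$$
   Context: Let $q\in(0,1)$. Notation: $(a;p)_0=1$, $(a;p)_k=\prod_{j=0}^{k-1}(1-ap^j)$, $(a;p)_\infty=\prod_{j\ge0}(1-ap^j)$; $[a]_p=\frac{1-p^a}{1-p}$; the $p$-Gamma function is $\Gamma_p(x)=\frac{(p;p)_\infty}{(p^x;p)_\infty}(1-p)^{1-x}$. The $q$-modified Bessel function of the first kind is given by $$I^{(1)}_\nu\left((1-q^2)z;q^2\right)=\frac{1}{\Gamma_{q^2}(\nu+1)}\sum_{k=0}^\infty\frac{(1-q^2)^{2k}z^{2k+\nu}}{2^{2k+\nu}(q^2;q^2)_k(q^{2\nu+2};q^2)_k},\qquad |z|<\frac{1}{1-q^2},$$ and the normalized $q$-modified Bessel function of the first kind is $$\mathcal{I}_\nu(z;q^2)=(1+q)^\nu\frac{\Gamma_{q^2}(\nu+1)}{z^\nu}I^{(1)}_\nu\left(2(1-q)z;q^2\right).$$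 For $|x|<\frac{1}{(1-q)^2}$, the $q$-Dunkl kernel is defined by $$E_\nu(x;q^2)=\mathcal{I}_\nu(x;q^2)+\frac{x}{(1+q)[\nu+1]_{q^2}}\,\mathcal{I}_{\nu+1}(x;q^2).$$ *)

(* Defs.v *)
From HB Require Import structures.
From mathcomp Require Export all_boot all_order all_algebra.
From mathcomp Require Export all_classical all_reals all_analysis.

Set Implicit Arguments.
Unset Strict Implicit.
Unset Printing Implicit Defensive.
Import Order.TTheory GRing.Theory Num.Theory.
Import numFieldNormedType.Exports.
Local Open Scope ring_scope.

Definition qpoch (R : realType) (a p : R) (k : nat) : R :=
  \prod_(j < k) (1 - a * p ^+ j).

Definition qpoch_inf (R : realType) (a p : R) : R :=
  limn (fun n : nat => qpoch a p n).

Definition qnumber (R : realType) (p a : R) : R := (1 - p `^ a) / (1 - p).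

Definition qGamma (R : realType) (p x : R) : R :=
  qpoch_inf p p / qpoch_inf (p `^ x) p * (1 - p) `^ (1 - x).

(* The functions below are used for arguments >= 0 only, where all the terms
   of the series are nonnegative. Their values live in \bar R: a convergent
   series has its usual real sum, a divergent one has the value +oo. *)

(* I^(1)_nu(y; q^2), as a function of its actual first argument y.  The usual
   defining formula is written in the variable z with y = (1 - q^2) z. *)
Definition qBesselI (R : realType) (q nu y : R) : \bar R :=
  let z := y / (1 - q ^+ 2) in
  (((qGamma (q ^+ 2) (nu + 1))^-1)%:E *
   \sum_(0 <= k <oo)
     ((1 - q ^+ 2) ^+ (2 * k) * z `^ ((2 * k)%:R + nu) /
      (2 `^ ((2 * k)%:R + nu) * qpoch (q ^+ 2) (q ^+ 2) k *
       qpoch (q `^ (2 * nu + 2)) (q ^+ 2) k))%:E)%E.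

(* At z = 0 the quotient by z^nu is a removable singularity: after
   cancellation the power series in z has constant term 1.  The series
   converges exactly when `|z| < 1 / (1 - q). *)
Definition qBesselI_normalized (R : realType) (q nu z : R) : \bar R :=
  if z == 0 then 1%E
  else (((1 + q) `^ nu * (qGamma (q ^+ 2) (nu + 1) / z `^ nu))%:E *
        qBesselI q nu (2 * (1 - q) * z))%E.

Definition qDunkl (R : realType) (q nu x : R) : \bar R :=
  (qBesselI_normalized q nu x +
   (x / ((1 + q) * qnumber (q ^+ 2) (nu + 1)))%:E *
   qBesselI_normalized q (nu + 1) x)%E.

(* Main.v *)
(** Write t = lambda x and p = q^2.  After cancellation of the Gamma factors
    (which are nonzero), and since the factor 1 - q^(2 nu + 2) coming from
    [nu + 1]_p merges with (q^(2 nu + 4); p)_k into (q^(2 nu + 2); p)_(k + 1),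
    the kernel E_nu(t) is a series with nonnegative coefficients in the functions
    nu |-> 1 / (q^(2 nu + 2); p)_m.  Each of them is log-convex: q^(2 nu + 2) is
    log-linear in nu, and weighted AM-GM gives
    a^al b^(1 - al) + (1 - a)^al (1 - b)^(1 - al) <= 1.
    Log-convexity passes to nonnegative combinations and to series, and the
    Turan inequality is the midpoint case. *)
Require Import Defs.
From mathcomp Require Import ring lra.
Set Implicit Arguments.
Unset Strict Implicit.
Unset Printing Implicit Defensive.
Import Order.TTheory GRing.Theory Num.Theory.
Local Open Scope ring_scope.

(** * Real powers and weighted AM-GM *)

(** Young's inequality with the conjugate exponents [a^-1] and [(1 - a)^-1]. *)
Lemma powR_amgm (R : realType) (a x y : R) : 0 < a < 1 -> 0 <= x -> 0 <= y ->
  x `^ a * y `^ (1 - a) <= a * x + (1 - a) * y.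
Proof.
move=> /andP[a0 a1] x0 y0.
have b0 : 0 < 1 - a by rewrite subr_gt0.
have := @conjugate_powR R (x `^ a) (y `^ (1 - a)) a^-1 (1 - a)^-1
  (powR_ge0 _ _) (powR_ge0 _ _).
rewrite !invr_gt0 => /(_ a0 b0); rewrite !invrK => /(_ (subrKC _ _)).
rewrite -!powRrM !mulfV ?gt_eqF// !powRr1//.
by rewrite (mulrC x) (mulrC y).
Qed.

Lemma powR_split (R : realType) (a x : R) : 0 <= x ->
  x `^ a * x `^ (1 - a) = x.
Proof.
move=> x0; rewrite -powRD ?subrKC ?powRr1//.
by rewrite oner_eq0.
Qed.

Lemma powR_inv (R : realType) (x r : R) : 0 <= x -> x^-1 `^ r = (x `^ r)^-1.
Proof. by move=> x0; rewrite -(powR_inv1 x0) -powRrM mulN1r powRN. Qed.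

(** * q-Pochhammer symbols: positivity and log-concavity in the base *)

Lemma qpoch_factor_gt0 (R : realType) (p a : R) j : 0 <= p < 1 ->
  0 <= a < 1 -> 0 < 1 - a * p ^+ j.
Proof.
move=> /andP[p0 p1] /andP[a0 a1]; rewrite subr_gt0; apply: le_lt_trans a1.
by rewrite ler_piMr// exprn_ile1// ltW.
Qed.

(** Splits off the first factor rather than the last, so that the base is shifted to [a * p]; this
    is the shift caused by [nu + 1]. *)
Lemma qpochS (R : realType) (a p : R) k : qpoch a p k.+1 = (1 - a) * qpoch (a * p) p k.
Proof.
rewrite /qpoch big_ord_recl expr0 mulr1; congr (_ * _).
by apply: eq_bigr => j _; rewrite /= /bump/= add1n exprS mulrA.
Qed.

Lemma qpoch_gt0 (R : realType) (p a : R) k : 0 <= p < 1 -> 0 <= a < 1 ->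
  0 < qpoch a p k.
Proof. by move=> p01 a01; apply: prodr_gt0 => j _; exact: qpoch_factor_gt0. Qed.

(* [1 / (1 - s) = 1 + s / (1 - s) <= expR (s / (1 - a))] for [s <= a], applied
   to [s = a p^j]; the exponents sum to at most [a / (1 - p) / (1 - a)]. *)
Lemma qpoch_ge (R : realType) (p a : R) k : 0 <= p < 1 -> 0 <= a < 1 ->
  expR (- (a / (1 - p) / (1 - a))) <= qpoch a p k.
Proof.
move=> p01 a01; have /andP[a0 a1] := a01; have /andP[p0 p1] := p01.
have Ha : 0 < 1 - a by rewrite subr_gt0.
have Hp : 0 < 1 - p by rewrite subr_gt0.
apply: (@le_trans _ _ (\prod_(j < k) expR (- (a * p ^+ j / (1 - a))))).
  rewrite -expR_sum ler_expR sumrN lerN2 -mulr_suml ler_pM2r ?invr_gt0//.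
  rewrite -mulr_sumr ler_wpM2l// -[leRHS]mul1r ler_pdivlMr// mulrC.
  by rewrite -opprB mulNr -subrX1 opprB gerBl exprn_ge0.
apply: ler_prod => j _; rewrite expR_ge0/= expRN.
have s0 := qpoch_factor_gt0 j p01 a01.
rewrite -[leRHS]invrK lef_pV2 ?posrE ?invr_gt0 ?expR_gt0//.
apply: le_trans (expR_ge1Dx _).
have -> : (1 - a * p ^+ j)^-1 = 1 + a * p ^+ j / (1 - a * p ^+ j).
  by field; rewrite gt_eqF.
rewrite lerD2l ler_wpM2l ?mulr_ge0 ?exprn_ge0// lef_pV2 ?posrE//.
by rewrite lerD2l lerN2 ler_piMr// exprn_ile1// ltW.
Qed.

(** Positive partial products could still tend to 0; the bound of [qpoch_ge] is uniform in [k] and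
    survives the limit, which exists by monotonicity. *)
Lemma qpoch_inf_gt0 (R : realType) (p a : R) : 0 <= p < 1 -> 0 <= a < 1 ->
  0 < qpoch_inf a p.
Proof.
move=> p01 a01; have /andP[p0 p1] := p01.
apply: lt_le_trans (expR_gt0 (- (a / (1 - p) / (1 - a)))) _.
apply: limr_ge; last by apply: nearW => n; exact: qpoch_ge.
apply: nonincreasing_is_cvgn.
  apply/nonincreasing_seqP => n; rewrite /qpoch big_ord_recr/=.
  rewrite ler_piMr //; first by rewrite ltW ?(qpoch_gt0 n p01 a01).
  by rewrite gerBl mulr_ge0 ?exprn_ge0//; case/andP: a01.
by exists 0 => _ [n _ <-]; rewrite ltW// qpoch_gt0.
Qed.

Lemma qpoch_log_concave (R : realType) (p al a b : R) k :
  0 <= p < 1 -> 0 < al < 1 ->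
  0 <= a < 1 -> 0 <= b < 1 ->
  qpoch a p k `^ al * qpoch b p k `^ (1 - al) <=
  qpoch (a `^ al * b `^ (1 - al)) p k.
Proof.
move=> p01 al01 a01 b01; have /andP[p0 _] := p01; have /andP[a0 _] := a01; have /andP[b0 _] := b01.
elim: k => [|k IH].
  by rewrite /qpoch !big_ord0 !powR1 mulr1.
have /ltW A0 := qpoch_gt0 k p01 a01; have /ltW B0 := qpoch_gt0 k p01 b01.
have /ltW ha := qpoch_factor_gt0 k p01 a01.
have /ltW hb := qpoch_factor_gt0 k p01 b01.
move: A0 B0 IH; rewrite /qpoch !big_ord_recr/= => A0 B0 IH.
rewrite !powRM//.
rewrite mulrACA ler_pM ?mulr_ge0 ?powR_ge0//.
have pk0 : 0 <= p ^+ k by rewrite exprn_ge0.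
(* Splitting [p ^+ k] into its powers of exponents [al] and [1 - al] attaches one copy to [a] and
   one to [b]. *)
rewrite -{3}(powR_split al pk0) mulrACA -!powRM//.
(* The upper bounds in [h1] and [h2] add up to exactly 1. *)
have h1 := powR_amgm al01 ha hb.
have h2 := powR_amgm al01 (mulr_ge0 a0 pk0) (mulr_ge0 b0 pk0).
by lra.
Qed.

(** Log-convexity in additive form: weights [c], [d] of weighted geometric mean 1 do not change the
    product bounded by AM-GM. The bound is linear in the reciprocals, hence summable, and [c], [d]
    stay free to be optimised after summation. *)
Lemma qpochV_log_convex (R : realType) (p al a b c d : R) k :
  0 <= p < 1 -> 0 < al < 1 ->
  0 <= a < 1 -> 0 <= b < 1 -> 0 <= c -> 0 <= d ->
  c `^ al * d `^ (1 - al) = 1 ->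
  (qpoch (a `^ al * b `^ (1 - al)) p k)^-1 <=
  al * (c * (qpoch a p k)^-1) + (1 - al) * (d * (qpoch b p k)^-1).
Proof.
move=> p01 al01 a01 b01 c0 d0 cd.
have A0 := qpoch_gt0 k p01 a01; have B0 := qpoch_gt0 k p01 b01.
have iA0 : 0 <= (qpoch a p k)^-1 by rewrite invr_ge0 ltW.
have iB0 : 0 <= (qpoch b p k)^-1 by rewrite invr_ge0 ltW.
apply: le_trans (powR_amgm al01 (mulr_ge0 c0 iA0) (mulr_ge0 d0 iB0)).
rewrite !powRM// mulrACA cd mul1r (powR_inv _ (ltW A0)) (powR_inv _ (ltW B0)) -invfM.
have AB0 : 0 < qpoch a p k `^ al * qpoch b p k `^ (1 - al).
  by rewrite mulr_gt0 ?powR_gt0.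
have le := qpoch_log_concave k p01 al01 a01 b01.
by rewrite lef_pV2 ?posrE// (lt_le_trans AB0).
Qed.


(** * Positivity of the q-Gamma function *)

Lemma powR_in01 (R : realType) (p x : R) : 0 < p < 1 -> 0 < x ->
  0 <= p `^ x < 1.
Proof.
move=> /andP[p0 p1] x0; have -> : 1 = 1 `^ x :> R by rewrite powR1.
by rewrite powR_ge0 gt0_ltr_powR ?nnegrE ?ler01// ltW.
Qed.

Lemma sqr_in01 (R : realType) (q : R) : 0 < q < 1 -> 0 < q ^+ 2 < 1.
Proof. by move=> /andP[q0 q1]; rewrite exprn_gt0// exprn_ilt1 ?ltW. Qed.

Lemma qGamma_gt0 (R : realType) (p x : R) : 0 < p < 1 -> 0 < x ->
  0 < qGamma p x.
Proof.
move=> p01 x0; have /andP[p0 p1] := p01.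
have p01' : 0 <= p < 1 by rewrite ltW.
rewrite /qGamma mulr_gt0 ?powR_gt0 ?subr_gt0// divr_gt0// qpoch_inf_gt0//.
exact: powR_in01.
Qed.

(** * Series of the normalized Bessel function *)

Definition qBesselI_term (R : realType) (q nu t : R) (k : nat) : R :=
  ((1 - q) * t) ^+ (2 * k) /
  (qpoch (q ^+ 2) (q ^+ 2) k * qpoch (q `^ (2 * nu + 2)) (q ^+ 2) k).

Lemma qBesselI_term_ge0 (R : realType) (q nu t : R) k : 0 < q < 1 -> 0 < nu ->
  0 <= t -> 0 <= qBesselI_term q nu t k.
Proof.
move=> q01 nu0 t0; have /andP[q0 q1] := q01.
have /andP[p0 p1] := sqr_in01 q01.
have p01 : 0 <= q ^+ 2 < 1 by rewrite ltW.
have a01 : 0 <= q `^ (2 * nu + 2) < 1 by apply: powR_in01 => //; lra.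
rewrite divr_ge0//; first by rewrite exprn_ge0// mulr_ge0// subr_ge0 ltW.
by rewrite mulr_ge0// ltW// qpoch_gt0.
Qed.

Lemma qBesselI_normalizedE (R : realType) (q nu t : R) :
  0 < q < 1 -> 0 < nu -> 0 <= t ->
  qBesselI_normalized q nu t =
  (\sum_(0 <= k <oo) (qBesselI_term q nu t k)%:E)%E.
Proof.
move=> q01 nu0 t0; have /andP[q0 q1] := q01.
rewrite /qBesselI_normalized; case: eqVneq => [->|tn0].
  (* At [t = 0] only the term [k = 0] survives, and it equals 1, the value set by the definition. *)
  rewrite nneseries_recl => [|k _|//]; last by rewrite lee_fin qBesselI_term_ge0.
  rewrite eseries0 => [|[//|k] _ _]; last first.
    by rewrite /qBesselI_term mulr0 mulnS expr0n/= mul0r.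
  by rewrite /qBesselI_term /qpoch !big_ord0 muln0 expr0 mulr1 divr1 adde0.
have {t0 tn0} t0 : 0 < t by rewrite lt_neqAle eq_sym tn0.
have G0 : 0 < qGamma (q ^+ 2) (nu + 1).
  by apply: qGamma_gt0; [exact: sqr_in01|lra].
rewrite /qBesselI.
have -> : 2 * (1 - q) * t / (1 - q ^+ 2) = 2 * (t / (1 + q)).
  by field; rewrite !gt_eqF; lra || nra.
have w0 : 0 < t / (1 + q) by rewrite divr_gt0//; lra.
rewrite muleA -EFinM.
set c := (X in (X%:E * _)%E).
(* The Gamma factors cancel; what remains of [c] is the inverse of the [nu]-th power of
   [t / (1 + q)] contained in every term. *)
have cE : c = (1 + q) `^ nu / t `^ nu.
  by rewrite /c; field; rewrite !gt_eqF ?powR_gt0.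
have c0 : 0 < c by rewrite cE divr_gt0 ?powR_gt0//; lra.
have E k : c * ((1 - q ^+ 2) ^+ (2 * k) * (2 * (t / (1 + q))) `^ ((2 * k)%:R + nu) /
      (2 `^ ((2 * k)%:R + nu) * qpoch (q ^+ 2) (q ^+ 2) k *
       qpoch (q `^ (2 * nu + 2)) (q ^+ 2) k)) = qBesselI_term q nu t k.
  rewrite powRM ?ltW// -mulrA -[2 `^ _ * _ * _]mulrA invfM.
  rewrite [X in c * (_ * X)]mulrACA [2 `^ _ / _]mulfV ?gt_eqF ?powR_gt0// mul1r.
  rewrite [(t / (1 + q)) `^ _]powRD ?(gt_eqF w0) ?implybT//.
  rewrite powR_mulrn ?ltW//.
  have -> : (t / (1 + q)) `^ nu = c^-1.
    rewrite cE invf_div powRM ?invr_ge0 ?ltW//; last lra.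
    by rewrite powR_inv//; lra.
  rewrite /qBesselI_term.
  have -> : (1 - q) * t = (1 - q ^+ 2) * (t / (1 + q)).
    by field; rewrite gt_eqF//; lra.
  rewrite [in RHS]exprMn; set P := (qpoch _ _ _ * _)^-1.
  by field; rewrite gt_eqF.
rewrite -nneseriesZl => [|k _]; last first.
  by rewrite lee_fin -(pmulr_rge0 _ c0) E qBesselI_term_ge0// ltW.
by apply: eq_eseriesr => k _; rewrite -EFinM E.
Qed.

(** * Series of the q-Dunkl kernel *)

Definition qDunkl_term (R : realType) (q nu t : R) (k : nat) : R :=
  ((1 - q) * t) ^+ (2 * k) / qpoch (q ^+ 2) (q ^+ 2) k *
  ((qpoch (q `^ (2 * nu + 2)) (q ^+ 2) k)^-1 +
   (1 - q) * t * (qpoch (q `^ (2 * nu + 2)) (q ^+ 2) k.+1)^-1).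

Lemma qDunkl_termE (R : realType) (q nu t : R) k :
  0 < q < 1 -> 0 < nu ->
  qBesselI_term q nu t k +
    t / ((1 + q) * qnumber (q ^+ 2) (nu + 1)) * qBesselI_term q (nu + 1) t k =
  qDunkl_term q nu t k.
Proof.
move=> q01 nu0; have /andP[q0 q1] := q01.
have /andP[p0 p1] := sqr_in01 q01.
have p01 : 0 <= q ^+ 2 < 1 by rewrite ltW.
have a01 : 0 <= q `^ (2 * nu + 2) < 1 by apply: powR_in01 => //; lra.
have b01 : 0 <= q `^ (2 * (nu + 1) + 2) < 1 by apply: powR_in01 => //; lra.
rewrite /qDunkl_term /qBesselI_term qpochS /qnumber.
have -> : (q ^+ 2) `^ (nu + 1) = q `^ (2 * nu + 2).
  by rewrite -powR_mulrn ?ltW// -powRrM mulrDr mulr1.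
have bE : q `^ (2 * nu + 2) * q ^+ 2 = q `^ (2 * (nu + 1) + 2).
  rewrite -powR_mulrn ?ltW// -powRD ?(gt_eqF q0) ?implybT//.
  by congr (_ `^ _); ring.
rewrite bE.
have A0 := qpoch_gt0 k p01 a01.
have B0 := qpoch_gt0 k p01 b01.
have C0 : 0 < qpoch (q ^+ 2) (q ^+ 2) k by apply: qpoch_gt0.
have D0 : 0 < 1 - q `^ (2 * nu + 2) by rewrite subr_gt0; case/andP: a01.
by field; rewrite !gt_eqF//; lra || nra.
Qed.

Lemma qDunkl_term_ge0 (R : realType) (q nu t : R) k :
  0 < q < 1 -> 0 < nu -> 0 <= t -> 0 <= qDunkl_term q nu t k.
Proof.
move=> q01 nu0 t0; have /andP[q0 q1] := q01.
have /andP[p0 p1] := sqr_in01 q01.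
have p01 : 0 <= q ^+ 2 < 1 by rewrite ltW.
have a01 : 0 <= q `^ (2 * nu + 2) < 1 by apply: powR_in01 => //; lra.
have r0 : 0 <= (1 - q) * t by rewrite mulr_ge0//; lra.
rewrite /qDunkl_term mulr_ge0 ?divr_ge0 ?exprn_ge0//.
  by rewrite ltW ?qpoch_gt0.
have P0 j := ltW (qpoch_gt0 j p01 a01).
by apply: addr_ge0; [|apply: mulr_ge0 => //]; rewrite invr_ge0.
Qed.

Lemma qDunklE (R : realType) (q nu t : R) :
  0 < q < 1 -> 0 < nu -> 0 <= t ->
  qDunkl q nu t = (\sum_(0 <= k <oo) (qDunkl_term q nu t k)%:E)%E.
Proof.
move=> q01 nu0 t0; have /andP[q0 q1] := q01.
have nu1 : 0 < nu + 1 by lra.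
have /andP[p0 p1] := sqr_in01 q01.
rewrite /qDunkl !qBesselI_normalizedE//.
have c0 : 0 <= t / ((1 + q) * qnumber (q ^+ 2) (nu + 1)).
  rewrite divr_ge0// mulr_ge0//; first lra.
  have /andP[_ /ltW s1] := powR_in01 (sqr_in01 q01) nu1.
  by rewrite divr_ge0// subr_ge0// ltW.
rewrite -nneseriesZl => [|k _]; last by rewrite lee_fin qBesselI_term_ge0.
rewrite -nneseriesD => [|k _ _|k _ _].
- by apply: eq_eseriesr => k _; rewrite -EFinM -EFinD qDunkl_termE.
- by rewrite lee_fin qBesselI_term_ge0.
- by rewrite -EFinM lee_fin mulr_ge0// qBesselI_term_ge0.
Qed.

(** The term [k = 0] is already at least 1. Strict positivity permits division by the kernel and
    determines products with [+oo]. *)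
Lemma qDunkl_gt0 (R : realType) (q nu t : R) :
  0 < q < 1 -> 0 < nu -> 0 <= t -> (0 < qDunkl q nu t)%E.
Proof.
move=> q01 nu0 t0; have /andP[q0 q1] := q01.
have a01 : 0 <= q `^ (2 * nu + 2) < 1 by apply: powR_in01 => //; lra.
rewrite qDunklE//.
apply: (@lt_le_trans _ _ (qDunkl_term q nu t 0)%:E); last first.
  have := @nneseries_lim_ge R (fun k => (qDunkl_term q nu t k)%:E) xpredT 0 1.
  rewrite big_nat1; apply => k _ _.
  by rewrite lee_fin qDunkl_term_ge0.
rewrite lte_fin /qDunkl_term /qpoch !big_ord0 big_ord1 muln0 !expr0 invr1 !mul1r.
have /andP[_ a1] := a01.
rewrite ltr_pwDl// mulr_ge0//; first by rewrite mulr_ge0// subr_ge0 ltW.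
by rewrite invr_ge0 mulr1 subr_ge0 ltW.
Qed.

(** * Log-convexity of the kernel and the Turan inequality *)

(** The order enters only through the reciprocals at [k] and [k.+1]; both are bounded with the same
    weights [c], [d], which do not depend on [k]. *)
Lemma qDunkl_term_log_convex (R : realType) (q nu1 nu2 al c d t : R) k :
  0 < q < 1 -> 0 < nu1 -> 0 < nu2 -> 0 < al < 1 -> 0 <= c -> 0 <= d ->
  c `^ al * d `^ (1 - al) = 1 -> 0 <= t ->
  qDunkl_term q (al * nu1 + (1 - al) * nu2) t k <=
  al * c * qDunkl_term q nu1 t k + (1 - al) * d * qDunkl_term q nu2 t k.
Proof.
move=> q01 n1 n2 al01 c0 d0 cd t0; have /andP[q0 q1] := q01.
have /andP[p0 p1] := sqr_in01 q01.
have p01 : 0 <= q ^+ 2 < 1 by rewrite ltW.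
have a01 : 0 <= q `^ (2 * nu1 + 2) < 1 by apply: powR_in01 => //; lra.
have b01 : 0 <= q `^ (2 * nu2 + 2) < 1 by apply: powR_in01 => //; lra.
have r0 : 0 <= (1 - q) * t by rewrite mulr_ge0//; lra.
rewrite /qDunkl_term.
have -> : q `^ (2 * (al * nu1 + (1 - al) * nu2) + 2) =
    (q `^ (2 * nu1 + 2)) `^ al * (q `^ (2 * nu2 + 2)) `^ (1 - al).
  rewrite -!powRrM -powRD ?(gt_eqF q0) ?implybT//.
  by congr (_ `^ _); ring.
have h1 := qpochV_log_convex k p01 al01 a01 b01 c0 d0 cd.
have h2 := qpochV_log_convex k.+1 p01 al01 a01 b01 c0 d0 cd.
set w := (X in X * _).
have w0 : 0 <= w.
  by rewrite divr_ge0 ?exprn_ge0// ltW ?qpoch_gt0.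
rewrite !(mulrCA _ w) -mulrDr ler_wpM2l//.
apply: le_trans (lerD h1 (ler_wpM2l r0 h2)) _.
by rewrite le_eqVlt; apply/orP; left; apply/eqP; ring.
Qed.

(* The scalings [c = (V / U) `^ (1 - al)] and [d = (U / V) `^ al] turn the
   termwise weighted bound, which can be summed, into [U `^ al * V `^ (1 - al)];
   this replaces Hoelder's inequality for series. *)
Lemma qDunkl_log_convex (R : realType) (q nu1 nu2 al t : R) :
  0 < q < 1 -> 0 < nu1 -> 0 < nu2 -> 0 <= al <= 1 -> 0 <= t ->
  (qDunkl q (al * nu1 + (1 - al) * nu2) t <=
   qDunkl q nu1 t `^ al * qDunkl q nu2 t `^ (1 - al))%E.
Proof.
move=> q01 n1 n2 /andP[al0 al1] t0.
have U0 := qDunkl_gt0 q01 n1 t0; have V0 := qDunkl_gt0 q01 n2 t0.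
(* AM-GM was set up for [0 < al < 1]; at the endpoints equality holds, the zeroth power being 1 even
   at [+oo]. *)
have [->|aln0] := eqVneq al 0.
  by rewrite mul0r add0r subr0 mul1r poweRe0 mul1e poweRe1// ltW.
have [->|aln1] := eqVneq al 1.
  by rewrite subrr mul0r addr0 mul1r poweRe0 mule1 poweRe1// ltW.
have al01 : 0 < al < 1 by rewrite !lt_neqAle eq_sym aln0 al0 aln1.
have [al0' al1'] := andP al01.
have n0 : 0 < al * nu1 + (1 - al) * nu2.
  by rewrite addr_gt0// mulr_gt0// subr_gt0.
move: U0 V0; rewrite (qDunklE q01 n1 t0) (qDunklE q01 n2 t0) (qDunklE q01 n0 t0).
move EU : (\sum_(0 <= k <oo) (qDunkl_term q nu1 t k)%:E)%E => U.
move EV : (\sum_(0 <= k <oo) (qDunkl_term q nu2 t k)%:E)%E => V.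
(* Positivity excludes [-oo]. If one sum is [+oo], so is its power, and the other factor is
   positive: the right-hand side is [+oo]. This does occur, since the series diverge once
   [(1 - q) * t >= 1]. *)
move: U V EU EV => [U| |] [V| |] EU EV U0 V0 //; last 3 first.
- by rewrite (@poweRyr _ (1 - al)) ?subr_eq0 1?eq_sym// gt0_muley ?poweR_gt0// leey.
- by rewrite poweRyr// gt0_mulye ?poweR_gt0// leey.
- by rewrite poweRyr// gt0_mulye ?poweR_gt0// leey.
rewrite !lte_fin in U0 V0.
pose c := (V / U) `^ (1 - al); pose d := (U / V) `^ al.
have VU0 : 0 < V / U by rewrite divr_gt0.
have cd : c `^ al * d `^ (1 - al) = 1.
  rewrite /c /d -!powRrM [al * _]mulrC -powRM ?divr_ge0 ?ltW//.
  by rewrite -(invf_div U V) mulVf ?powR1// gt_eqF// divr_gt0.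
have c0 : 0 <= c by exact: powR_ge0.
have d0 : 0 <= d by exact: powR_ge0.
(* One part of the split of [U] cancels the denominator in [c]; [d * V] then reaches the same
   value. *)
have cU : c * U = U `^ al * V `^ (1 - al).
  rewrite /c powRM ?invr_ge0 ?ltW// -{2}(powR_split al (ltW U0)).
  rewrite powR_inv ?ltW//.
  by field; rewrite gt_eqF ?powR_gt0.
have dV : d * V = U `^ al * V `^ (1 - al).
  rewrite /d powRM ?invr_ge0 ?ltW// -{2}(powR_split al (ltW V0)).
  rewrite powR_inv ?ltW//.
  by field; rewrite gt_eqF ?powR_gt0.
have ac0 : 0 <= al * c by rewrite mulr_ge0.
have bd0 : 0 <= (1 - al) * d by rewrite mulr_ge0// subr_ge0.
apply: (@le_trans _ _ (\sum_(0 <= k <oo) ((al * c)%:E * (qDunkl_term q nu1 t k)%:E +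
   ((1 - al) * d)%:E * (qDunkl_term q nu2 t k)%:E))%E).
  apply: lee_nneseries => [k _ _|k _].
    by rewrite lee_fin qDunkl_term_ge0.
  by rewrite -!EFinM -EFinD lee_fin qDunkl_term_log_convex.
rewrite nneseriesD => [|k _ _|k _ _]; last 2 first.
- by rewrite -EFinM lee_fin mulr_ge0// qDunkl_term_ge0.
- by rewrite -EFinM lee_fin mulr_ge0// qDunkl_term_ge0.
rewrite !nneseriesZl => [|k _|k _]; last 2 first.
- by rewrite lee_fin qDunkl_term_ge0.
- by rewrite lee_fin qDunkl_term_ge0.
(* The two scaled sums coincide, so their combination with weights [al] and [1 - al] is that common
   value. *)
rewrite EU EV !poweR_EFin -!EFinM -EFinD lee_fin -!mulrA cU dV.
by rewrite -mulrDl subrKC mul1r.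
Qed.

Theorem theorem3 (R : realType) (q x lambda : R)
  (hq : 0 < q < 1)
  (hx : 0 <= x < 1 / (1 - q)) (hlambda : 0 <= lambda < 1 / (1 - q)) :
  (forall nu1 nu2 alpha : R, 0 < nu1 -> 0 < nu2 -> 0 <= alpha <= 1 ->
     (qDunkl q (alpha * nu1 + (1 - alpha) * nu2) (lambda * x) <=
      qDunkl q nu1 (lambda * x) `^ alpha *
      qDunkl q nu2 (lambda * x) `^ (1 - alpha))%E) /\
  (forall nu : R, 0 < nu ->
     (qDunkl q (nu + 1) (lambda * x) ^+ 2 <=
      qDunkl q nu (lambda * x) * qDunkl q (nu + 2) (lambda * x))%E).
Proof.
have t0 : 0 <= lambda * x.
  by rewrite mulr_ge0//; [case/andP: hlambda|case/andP: hx].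
split=> [nu1 nu2 al n1 n2 al01|nu n0]; first exact: qDunkl_log_convex.
have n1 : 0 < nu + 1 by lra.
have n2 : 0 < nu + 2 by lra.
(* [nu + 1] is the midpoint of [nu] and [nu + 2]. *)
have h01 : 0 <= (2^-1 : R) <= 1 by lra.
have := qDunkl_log_convex hq n0 n2 h01 t0.
have -> : 2^-1 * nu + (1 - 2^-1) * (nu + 2) = nu + 1 by field.
have -> : 1 - 2^-1 = 2^-1 :> R by field.
have U0 := qDunkl_gt0 hq n0 t0; have V0 := qDunkl_gt0 hq n2 t0.
have W0 := qDunkl_gt0 hq n1 t0.
(* The midpoint inequality is multiplied by itself; [half] then removes the square roots, for
   infinite values too. *)
rewrite expe2 => le; apply: le_trans (lee_pmul (ltW W0) (ltW W0) le le) _.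
have half (u : \bar R) : (0 <= u)%E -> (u `^ 2^-1 * u `^ 2^-1 = u)%E.
  by move=> u0; rewrite poweR12_sqrt// -expe2 sqr_sqrte.
by rewrite muleACA !half// ltW.
Qed.
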